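(* Let $n\ge 2$ be an integer. Every total simplex $\Delta$ of $\mathbf{H}^n\sqcup\partial\mathbf{H}^n$ has inradius $\delta^n_{n-1}(\Delta)\le \tanh^{-1}(1/n)$, with equality if and only if $\Delta$ is ideal and regular.
   Context: $\mathbf{H}^n$ is real hyperbolic space of dimension $n$ (curvature $-1$) with distance $d$ and isometry group $\operatorname{Isom}(\mathbf{H}^n)$; $\partial\mathbf{H}^n$ is its boundary at infinity, and $\mathbf{H}^n\sqcup\partial\mathbf{H}^n$ is the compactification. In the projective (Cayley–Klein) model, $\mathbf{H}^n$ is the open unit ball of $\mathbb{R}^n$, $\partial\mathbf{H}^n$ is the unit sphere, and geodesic subspaces and convex hulls are the Euclidean ones (affine subspaces intersected with the ball, Euclidean convex hulls). A simplex $\Delta$ is a sequence of $n+1$ points $v_0,\dots,v_n$ of $\mathbf{H}^n\sqcup\partial\mathbf{H}^n$, its vertices. It is ideal when all $v_i\in\partial\mathbf{H}^n$. It is total when its vertices are independent (affinely independent in the projective ball model), equivalently when their convex hull has non-empty interior. A total simplex is regular when its stabilizer in $\operatorname{Isom}(\mathbf{H}^n)$ (the isometries preserving the set of vertices) acts transitively on its flags of faces, i.e. realizes the full symmetric group $\mathfrak{S}_{n+1}$ of permutations of its vertices. For $0\le m\le n$, an $m$-face of $\Delta$ is the convex hull of $1+m$ of its vertices, and the $m$-skeleton $\Delta^{(m)}$ is the union of its $m$-faces; in particular $\Delta^{(n)}$ is the convex hull of all the vertices. The inradius is $\delta^n_{n-1}(\Delta)=\max\{d(p,\Delta^{(n-1)})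 : p\in\Delta^{(n)}\}$, where distances are computed in $\mathbf{H}^n$ (i.e. between points of $\Delta^{(n)}\cap\mathbf{H}^n$ and the set $\Delta^{(n-1)}\cap\mathbf{H}^n$). *)

(* Defs.v *)
From HB Require Import structures.
From mathcomp Require Import all_boot all_order all_algebra all_fingroup.
From mathcomp Require Import all_classical all_reals all_analysis.
From mathcomp Require Import ring lra.

Set Implicit Arguments.
Unset Strict Implicit.
Unset Printing Implicit Defensive.

Import Order.TTheory GRing.Theory Num.Theory.
Import numFieldNormedType.Exports.

Local Open Scope classical_set_scope.
Local Open Scope ring_scope.

Section HyperbolicFunctions.
Context {R : realType}.
Implicit Types x y : R.

Definition cosh x : R := (expR x + expR (- x)) / 2.
Definition sinh x : R := (expR x - expR (- x)) / 2.
Definition tanh x : R := sinh x / cosh x.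

(* Inverse of cosh on [0, +oo[, with domain [1, +oo[. *)
Definition acosh x : R := ln (x + Num.sqrt (x ^+ 2 - 1)).

(* Inverse of tanh, with domain ]-1, 1[. *)
Definition atanh x : R := ln ((1 + x) / (1 - x)) / 2.

Lemma acoshK x : 1 <= x -> 0 <= acosh x /\ cosh (acosh x) = x.
Proof.
move=> x1; rewrite /acosh /cosh.
set s := Num.sqrt _.
have s0 : 0 <= s by exact: sqrtr_ge0.
have s2 : s ^+ 2 = x ^+ 2 - 1.
  by rewrite sqr_sqrtr // subr_ge0 -[leLHS](expr1n R 2) lerXn2r // nnegrE; lra.
have xs0 : 0 < x + s by lra.
split; first by rewrite ln_ge0 //; lra.
rewrite expRN lnK ?posrE //.
have -> : (x + s)^-1 = x - s.
  apply: (mulfI (lt0r_neq0 xs0)); rewrite divff ?lt0r_neq0 //.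
  by rewrite mulrC -subr_sqr s2; ring.
by field.
Qed.

Lemma atanhK x : -1 < x < 1 -> tanh (atanh x) = x.
Proof.
move=> /andP[x0 x1]; rewrite /tanh /sinh /cosh /atanh.
set a := ln _ / 2.
have q0 : 0 < (1 + x) / (1 - x) by rewrite divr_gt0 //; lra.
have e0 : 0 < expR a by exact: expR_gt0.
have e2 : expR a ^+ 2 * (1 - x) = 1 + x.
  rewrite expr2 -expRD (_ : a + a = ln ((1 + x) / (1 - x))); last by rewrite /a; field.
  by rewrite lnK ?posrE // divfK // lt0r_neq0 //; lra.
rewrite expRN.
have ee0 : expR a ^+ 2 + 1 != 0 by rewrite lt0r_neq0 // ltr_wpDl // exprn_ge0 // ltW.
have -> : (expR a - (expR a)^-1) / 2 / ((expR a + (expR a)^-1) / 2)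
    = (expR a ^+ 2 - 1) / (expR a ^+ 2 + 1).
  by field; rewrite ee0 lt0r_neq0.
apply: (mulIf ee0); rewrite divfK //.
by lra.
Qed.

End HyperbolicFunctions.

Section ProjectiveModel.
Context {R : realType} {n : nat}.
Implicit Types x y p : 'rV[R]_n.

Definition dotp x y : R := \sum_(i < n) x 0 i * y 0 i.

Definition hspace : set 'rV[R]_n := [set x | dotp x x < 1].
Definition hboundary : set 'rV[R]_n := [set x | dotp x x = 1].
Definition hcompact : set 'rV[R]_n := hspace `|` hboundary.

(* The Cayley-Klein metric of curvature -1; meaningful on hspace only. *)
Definition hdist x y : R :=
  acosh ((1 - dotp x y) / Num.sqrt ((1 - dotp x x) * (1 - dotp y y))).

(* Meaningful when A meets hspace (the infimum is then over a nonempty set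
   bounded below by 0). *)
Definition hdist_set p (A : set 'rV[R]_n) : R :=
  inf [set hdist p q | q in A `&` hspace].

(* An isometry of the open ball together with its continuous extension to the
   closed ball; the values of g outside the closed ball are irrelevant. *)
Definition hisometry (g : 'rV[R]_n -> 'rV[R]_n) : Prop :=
  [/\ g @` hspace = hspace,
      forall x y, hspace x -> hspace y -> hdist (g x) (g y) = hdist x y &
      {within hcompact, continuous g}].

Definition simplex (v : 'I_n.+1 -> 'rV[R]_n) : Prop :=
  forall i, hcompact (v i).

Definition ideal_simplex (v : 'I_n.+1 -> 'rV[R]_n) : Prop :=
  forall i, hboundary (v i).

(* Affine independence. *)
Definition total_simplex (v : 'I_n.+1 -> 'rV[R]_n) : Prop :=
  forall c : 'I_n.+1 -> R,
    \sum_i c i = 0 -> \sum_i c i *: v i = 0 -> forall i, c i = 0.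

(* Any g as below stabilizes the set of vertices. *)
Definition regular_simplex (v : 'I_n.+1 -> 'rV[R]_n) : Prop :=
  forall s : 'S_n.+1, exists2 g, hisometry g & forall i, g (v i) = v (s i).

(* The convex hull of the vertices with index in I. *)
Definition face (v : 'I_n.+1 -> 'rV[R]_n) (I : {set 'I_n.+1}) :
    set 'rV[R]_n :=
  [set x | exists c : 'I_n.+1 -> R,
    [/\ forall i, 0 <= c i, \sum_(i in I) c i = 1 &
        x = \sum_(i in I) c i *: v i]].

Definition skeleton (v : 'I_n.+1 -> 'rV[R]_n) (m : nat) : set 'rV[R]_n :=
  \bigcup_(I in [set I : {set 'I_n.+1} | #|I| = m.+1]) face v I.

(* r is the maximum of d(p, (n-1)-skeleton) over the points p of the simplex;
   attainment is part of the definition. *)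
Definition is_inradius (v : 'I_n.+1 -> 'rV[R]_n) (r : R) : Prop :=
  let D := [set hdist_set p (skeleton v n.-1) | p in skeleton v n `&` hspace] in
  D r /\ ubound D r.

End ProjectiveModel.

(* Main.v *)
(** In the hyperboloid model, lift a point x of the closed ball to (1, x), write
    B for the Lorentz form, V_i for the lifted vertices and U_i for the dual
    basis, so that U_i is normal to the i-th facet; put w_i = sqrt (- B(U_i, U_i)).
    The incenter is Q = \sum_i w_i V_i, and cosh r = sqrt (1 + 1/q) for the
    inradius r, where q = B(Q, Q): a point P = \sum_i a_i V_i of the simplex with
    all a_i / w_i >= t satisfies B(P, P) >= t^2 q because the B(V_i, V_j) are
    nonnegative.

    With s = sqrt (q + 1) and h_i = B(V_i, Q), the vector
    U_i + (s w_i / h_i) V_i - (w_i / (s - 1)) Q is orthogonal to Q, hence has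
    nonpositive square. This reads w_i h_i / (s - 1) - 1 >= c_i B(V_i, V_i) >= 0
    with c_i > 0, and summing over i yields s >= n. In case of equality all these
    vectors vanish, so that B(V_i, V_i) = 0 and B(V_i, V_j) = m_i m_j for i <> j;
    every permutation of the rescaled vertices V_i / m_i then extends to a linear
    isometry of B. Conversely, isometries preserve cross-ratios of the B(V_i, V_j),
    and regularity makes all of these equal to 1, which brings back
    B(V_i, V_j) = m_i m_j and then q = n^2 - 1. *)
Require Import Defs.
From mathcomp Require Import all_boot all_order all_algebra all_fingroup.
From mathcomp Require Import all_classical all_reals all_analysis.
From mathcomp Require Import ring lra.

Set Implicit Arguments.
Unset Strict Implicit.
Unset Printing Implicit Defensive.

Import Order.TTheory GRing.Theory Num.Theory.
Import numFieldNormedType.Exports.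
Local Open Scope ring_scope.

(** * The Lorentz form and the lift of the closed ball to it *)

Section Minkowski.
Context {R : realType} {n : nat}.
Implicit Types (x y z : 'rV[R]_n) (X Y Z : 'rV[R]_(1 + n)) (a : R).

Lemma dotpC x y : dotp x y = dotp y x.
Proof. by apply: eq_bigr => i _; rewrite mulrC. Qed.

Lemma dotpDl x y z : dotp (x + y) z = dotp x z + dotp y z.
Proof. by rewrite /dotp -big_split; apply: eq_bigr => i _; rewrite mxE mulrDl. Qed.

Lemma dotpZl a x y : dotp (a *: x) y = a * dotp x y.
Proof. by rewrite /dotp mulr_sumr; apply: eq_bigr => i _; rewrite mxE mulrA. Qed.

Lemma dotp_ge0 x : 0 <= dotp x x.
Proof. by apply: sumr_ge0 => i _; rewrite -expr2 sqr_ge0. Qed.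

Lemma dotp_eq0 x : dotp x x = 0 -> x = 0.
Proof.
move=> /eqP; rewrite /dotp psumr_eq0; last by move=> i _; rewrite -expr2 sqr_ge0.
move=> /allP h; apply/rowP => i; rewrite mxE; apply/eqP.
by have := h i (mem_index_enum i); rewrite /= mulf_eq0 orbb.
Qed.

Lemma dotp_CS x y : dotp x y ^+ 2 <= dotp x x * dotp y y.
Proof.
have [y0|y0] := eqVneq (dotp y y) 0.
  move/dotp_eq0: (y0) => ->; rewrite (_ : dotp x 0 = 0) ?expr0n /=.
    by rewrite (_ : dotp 0 0 = 0) ?mulr0 //; apply: big1 => i _; rewrite mxE mul0r.
  by apply: big1 => i _; rewrite mxE mulr0.
have yp : 0 < dotp y y by rewrite lt_neqAle eq_sym y0 dotp_ge0.
have := dotp_ge0 (dotp y y *: x + - dotp x y *: y).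
rewrite !dotpDl !(dotpC _ (_ + _)) !dotpDl !dotpZl !(dotpC _ (_ *: _)) !dotpZl.
rewrite (dotpC y x) => h.
rewrite -subr_ge0 -(pmulr_rge0 _ yp); apply: le_trans h _.
by rewrite le_eqVlt; apply/orP; left; apply/eqP; ring.
Qed.

(* Sign convention: time-like vectors are those with positive square. *)
Definition mink X Y : R := X 0 0 * Y 0 0 - dotp (rsubmx X) (rsubmx Y).

Lemma minkC X Y : mink X Y = mink Y X.
Proof. by rewrite /mink mulrC dotpC. Qed.

Lemma minkDl X Y Z : mink (X + Y) Z = mink X Z + mink Y Z.
Proof. by rewrite /mink linearD dotpDl mxE; ring. Qed.

Lemma minkZl a X Y : mink (a *: X) Y = a * mink X Y.
Proof. by rewrite /mink linearZ dotpZl mxE; ring. Qed.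

Lemma minkDr X Y Z : mink X (Y + Z) = mink X Y + mink X Z.
Proof. by rewrite !(minkC X) minkDl. Qed.

Lemma minkZr a X Y : mink X (a *: Y) = a * mink X Y.
Proof. by rewrite !(minkC X) minkZl. Qed.

Lemma mink0l X : mink 0 X = 0.
Proof. by rewrite -(scale0r 0) minkZl mul0r. Qed.

Lemma mink_suml (I : finType) (F : I -> 'rV[R]_(1 + n)) Y :
  mink (\sum_i F i) Y = \sum_i mink (F i) Y.
Proof.
apply: (big_morph (fun X => mink X Y)); last exact: mink0l.
by move=> X Z; exact: minkDl.
Qed.

Lemma mink_sumr (I : finType) (F : I -> 'rV[R]_(1 + n)) X :
  mink X (\sum_i F i) = \sum_i mink X (F i).
Proof. by rewrite minkC mink_suml; apply: eq_bigr => i _; rewrite minkC. Qed.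

Lemma mink_eq0 X : X 0 0 = 0 -> mink X X = 0 -> X = 0.
Proof.
rewrite /mink => X0; rewrite X0 mulr0 sub0r => /eqP; rewrite oppr_eq0 => /eqP.
move=> /dotp_eq0 XR; rewrite -(hsubmxK X) XR.
rewrite -[RHS](@row_mx0 _ 1 1 n); congr row_mx.
by apply/rowP => i; rewrite !ord1 !mxE -[RHS]X0; congr (X _ _); exact: val_inj.
Qed.

(** Orthogonality expresses [X 0 0 * T 0 0] as a Euclidean product, and Cauchy-Schwarz then bounds
    [(T 0 0)^2 * mink X X] by minus the spatial square of [X] times [mink T T]. *)
Lemma timelike_orth X T : 0 < mink T T -> mink X T = 0 ->
  mink X X <= 0 /\ (mink X X = 0 -> X = 0).
Proof.
move=> T0 XT; have CS := dotp_CS (rsubmx X) (rsubmx T).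
have X0 := dotp_ge0 (rsubmx X); have TR0 := dotp_ge0 (rsubmx T).
move: T0 XT; rewrite {1}/mink {1}/mink => T0 /eqP; rewrite subr_eq0 => /eqP XT.
have t0 : 0 < T 0 0 * T 0 0 by lra.
move: CS; rewrite -XT => CS.
have H : (T 0 0 * T 0 0) * mink X X <=
    - (dotp (rsubmx X) (rsubmx X) * (T 0 0 * T 0 0 - dotp (rsubmx T) (rsubmx T))).
  rewrite /mink; nra.
have le0 : mink X X <= 0.
  by rewrite -(pmulr_rle0 _ t0); apply: le_trans H _; rewrite oppr_le0 mulr_ge0 // ltW.
split=> // e; move: H; rewrite e mulr0 oppr_ge0 pmulr_lle0 // => d0.
have d : dotp (rsubmx X) (rsubmx X) = 0 by apply/eqP; rewrite eq_le d0.
apply: mink_eq0 => //; move: e; rewrite /mink d subr0 => /eqP.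
by rewrite mulf_eq0 orbb => /eqP.
Qed.

(* Reverse Cauchy-Schwarz inequality. *)
Lemma mink_CS X T : 0 < mink T T -> mink X X * mink T T <= mink X T ^+ 2.
Proof.
move=> T0; have T0' : mink T T != 0 by rewrite gt_eqF.
have [|h _] := @timelike_orth (X - (mink X T / mink T T) *: T) T T0.
  by rewrite -scaleNr minkDl minkZl mulNr divfK // subrr.
move: h; rewrite -scaleNr !minkDl !minkZl !minkDr !minkZr (minkC T X) => h.
rewrite -subr_ge0.
have -> : mink X T ^+ 2 - mink X X * mink T T =
   - mink T T * (mink X X + - (mink X T / mink T T) * mink X T +
  - (mink X T / mink T T) *
  (mink X T + - (mink X T / mink T T) * mink T T)).
  by field.
by rewrite mulNr oppr_ge0 pmulr_rle0.
Qed.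

(** Were [Y 0 0 <= 0], the condition [0 < mink Y T] would make the product of the spatial parts
    larger in absolute value than [Y 0 0 * T 0 0], against Cauchy-Schwarz for two causal vectors. *)
Lemma future_timelike T Y : 0 < mink T T -> 0 < T 0 0 ->
  0 <= mink Y Y -> 0 < mink Y T -> 0 < Y 0 0.
Proof.
rewrite /mink => T0 t0 Y0 YT; rewrite ltNge; apply/negP => y0.
have CS := dotp_CS (rsubmx Y) (rsubmx T).
have TR0 := dotp_ge0 (rsubmx T); have YR0 := dotp_ge0 (rsubmx Y).
have yt : Y 0 0 * T 0 0 <= 0 by rewrite mulr_le0_ge0 // ltW.
have h1 : (Y 0 0 * T 0 0) ^+ 2 < dotp (rsubmx Y) (rsubmx T) ^+ 2 by nra.
have : dotp (rsubmx Y) (rsubmx Y) * dotp (rsubmx T) (rsubmx T) <=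
   (Y 0 0 * Y 0 0) * (T 0 0 * T 0 0) by apply: ler_pM => //; lra.
nra.
Qed.

Definition lift x : 'rV[R]_(1 + n) := row_mx 1%:M x.

Definition proj X : 'rV[R]_n := (X 0 0)^-1 *: rsubmx X.

Lemma row_mx00 (b : 'M[R]_1) x : row_mx b x 0 0 = b 0 0.
Proof. by rewrite -[RHS](row_mxEl b x); congr (row_mx _ _ _); exact: val_inj. Qed.

Lemma lift00 x : lift x 0 0 = 1.
Proof. by rewrite /lift row_mx00 mxE eqxx. Qed.

Lemma rsub_lift x : rsubmx (lift x) = x.
Proof. by rewrite /lift row_mxKr. Qed.

Lemma mink_lift x y : mink (lift x) (lift y) = 1 - dotp x y.
Proof. by rewrite /mink !lift00 !rsub_lift mulr1. Qed.

Lemma liftK x : proj (lift x) = x.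
Proof. by rewrite /proj lift00 rsub_lift invr1 scale1r. Qed.

Lemma projZ a X : a != 0 -> proj (a *: X) = proj X.
Proof.
by move=> a0; rewrite /proj linearZ mxE invfM scalerA mulrAC mulVf // mul1r.
Qed.

Lemma projK X : X 0 0 != 0 -> X 0 0 *: lift (proj X) = X.
Proof.
move=> X0; rewrite -[RHS]hsubmxK /lift scale_row_mx /proj scalerA divff // scale1r.
congr row_mx; apply/rowP => i; rewrite !ord1 !mxE eqxx mulr1.
by congr (X _ _); exact: val_inj.
Qed.

Lemma hspace_lift x : hspace x = (0 < mink (lift x) (lift x)) :> Prop.
Proof. by rewrite mink_lift subr_gt0. Qed.

Lemma hcompact_lift x : hcompact x <-> 0 <= mink (lift x) (lift x).
Proof.
rewrite mink_lift subr_ge0 le_eqVlt /hcompact /hspace /hboundary /=; split.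
  by move=> [] /= h; rewrite h ?eqxx ?orbT.
by move=> /orP[/eqP|]; [right|left].
Qed.

Lemma hboundary_lift x : hboundary x <-> mink (lift x) (lift x) = 0.
Proof.
rewrite mink_lift /hboundary /=; split=> [->|/eqP]; first by rewrite subrr.
by rewrite subr_eq0 => /eqP.
Qed.

Lemma hspace_proj X : 0 < mink X X -> X 0 0 != 0 -> hspace (proj X).
Proof.
move=> XX X0; rewrite hspace_lift; move: XX.
rewrite -{1 2}(projK X0) minkZl minkZr mulrA pmulr_rgt0 //.
by rewrite -expr2 lt_neqAle eq_sym sqrf_eq0 X0 sqr_ge0.
Qed.

(** Twice the product is [mink (lift x) (lift x) + mink (lift y) (lift y)] plus the squared
    Euclidean distance from [x] to [y]. *)
Lemma mink_lift_gt0 x y : hcompact x -> hcompact y -> x <> y ->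
  0 < mink (lift x) (lift y).
Proof.
rewrite !hcompact_lift !mink_lift => hx hy xy.
have : 0 < dotp (x - y) (x - y).
  rewrite lt_neqAle dotp_ge0 andbT; apply/eqP => /esym/dotp_eq0/eqP.
  by rewrite subr_eq0 => /eqP.
rewrite -scaleN1r !dotpDl !(dotpC _ (_ + _)) !dotpDl !dotpZl !(dotpC _ (_ *: _)) !dotpZl.
rewrite (dotpC y x); lra.
Qed.

Lemma mink_lift_in x y : hspace x -> hcompact y -> 0 < mink (lift x) (lift y).
Proof.
move=> hx hy; have [<-|/eqP xy] := eqVneq x y; first by rewrite -hspace_lift.
by apply: mink_lift_gt0 => //; left.
Qed.

Lemma acosh_inj (a b : R) : 1 <= a -> 1 <= b -> acosh a = acosh b -> a = b.
Proof. by move=> a1 b1 e; have [_ <-] := acoshK a1; rewrite e; have [_ ->] := acoshK b1. Qed.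

Lemma ler_acosh (a b : R) : 1 <= a -> a <= b -> acosh a <= acosh b.
Proof.
move=> a1 ab; rewrite /acosh ler_ln ?posrE.
- by rewrite lerD // ler_wsqrtr // lerD2r lerXn2r // nnegrE; lra.
- by rewrite ltr_pwDl ?sqrtr_ge0 //; lra.
- by rewrite ltr_pwDl ?sqrtr_ge0 //; lra.
Qed.

(** For future time-like vectors this is the hyperbolic cosine of the distance. Its invariance under
    positive scaling allows any representative of a point to be used. *)
Definition chord X Y : R := mink X Y / Num.sqrt (mink X X * mink Y Y).

Lemma hdistE x y : hdist x y = acosh (chord (lift x) (lift y)).
Proof. by rewrite /hdist /chord !mink_lift. Qed.

Lemma chordZ a X Y : 0 < a -> chord (a *: X) Y = chord X Y.
Proof.
move=> a0; rewrite /chord !minkZl !minkZr.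
rewrite (_ : a * (a * mink X X) * mink Y Y = a ^+ 2 * (mink X X * mink Y Y)); last by ring.
by rewrite sqrtrM ?sqr_ge0 // sqrtr_sqr gtr0_norm // -mulf_div divff ?gt_eqF // mul1r.
Qed.

Lemma chordC X Y : chord X Y = chord Y X.
Proof. by rewrite /chord minkC mulrC (mulrC (mink X X)) mulrC. Qed.

Lemma hdist_proj X Y : 0 < X 0 0 -> 0 < Y 0 0 ->
  hdist (proj X) (proj Y) = acosh (chord X Y).
Proof.
move=> X0 Y0; rewrite hdistE -(chordZ _ _ X0) projK ?gt_eqF //.
by rewrite chordC -(chordZ _ _ Y0) projK ?gt_eqF // chordC.
Qed.

Lemma chord_ge X Y (c : R) : 0 < mink X X -> 0 < mink Y Y -> 0 < mink X Y ->
  0 <= c -> c * (mink X X * mink Y Y) <= mink X Y ^+ 2 -> Num.sqrt c <= chord X Y.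
Proof.
move=> X0 Y0 XY c0 h; rewrite /chord ler_pdivlMr ?sqrtr_gt0 ?mulr_gt0 //.
by rewrite -sqrtrM // -(gtr0_norm XY) -sqrtr_sqr ler_wsqrtr.
Qed.

Lemma chord_ge1 X Y : 0 < mink X X -> 0 < mink Y Y -> 0 < mink X Y ->
  1 <= chord X Y.
Proof.
move=> X0 Y0 XY; rewrite -[leLHS]sqrtr1; apply: chord_ge => //.
by rewrite mul1r; apply: mink_CS.
Qed.

Lemma chord_lift_ge1 x y : hspace x -> hspace y -> 1 <= chord (lift x) (lift y).
Proof.
move=> hx hy; apply: chord_ge1; rewrite -?hspace_lift //.
by apply: mink_lift_in => //; left.
Qed.

Lemma hdist_ge0 x y : hspace x -> hspace y -> 0 <= hdist x y.
Proof. by move=> hx hy; rewrite hdistE; have [] := acoshK (chord_lift_ge1 hx hy). Qed.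

End Minkowski.

(** * Facet normals, the incenter and the value of the inradius *)

Section Simplex.
Context {R : realType} {n : nat} (v : 'I_n.+1 -> 'rV[R]_n).
Hypotheses (hn : (2 <= n)%N) (hv : simplex v) (hvt : total_simplex v).
Implicit Types (i j k : 'I_n.+1) (X Y Z P : 'rV[R]_(1 + n)) (a : 'I_n.+1 -> R).

Lemma exists_third i j : exists k, k != i /\ k != j.
Proof.
have : (#|[set i; j]| < #|'I_n.+1|)%N.
  by rewrite card_ord ltnS (leq_trans _ hn) // cards2; case: (_ != _).
rewrite -cardsT ltnNge => /negP h.
have /subsetPn[k _] : ~~ ([set: 'I_n.+1] \subset [set i; j]).
  by apply/negP => /subset_leq_card.
by rewrite !inE negb_or => /andP[ki kj]; exists k.
Qed.

Definition vtx i : 'rV[R]_(1 + n) := lift (v i).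

Definition vmx : 'M[R]_(1 + n) := \matrix_i vtx i.

Lemma row_eq00 X Y : X 0 0 = Y 0 0 -> rsubmx X = rsubmx Y -> X = Y.
Proof.
move=> e0 er; rewrite -[X]hsubmxK -[Y]hsubmxK er; congr row_mx.
apply/rowP => i; rewrite !ord1 !mxE.
by rewrite (_ : lshift n 0 = 0) //; exact: val_inj.
Qed.

Lemma comb_vtx00 a : (\sum_i a i *: vtx i) 0 0 = \sum_i a i.
Proof. by rewrite summxE; apply: eq_bigr => i _; rewrite mxE lift00 mulr1. Qed.

Lemma comb_vtx_rsub a : rsubmx (\sum_i a i *: vtx i) = \sum_i a i *: v i.
Proof.
by rewrite linear_sum; apply: eq_bigr => i _; rewrite linearZ /= rsub_lift.
Qed.

Lemma lift_comb x a : \sum_i a i = 1 -> x = \sum_i a i *: v i ->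
  lift x = \sum_i a i *: vtx i.
Proof.
move=> a1 xE; apply: row_eq00; first by rewrite lift00 comb_vtx00.
by rewrite rsub_lift comb_vtx_rsub.
Qed.

(** Affine independence of the vertices is linear independence of their lifts, coordinate 0 of a
    combination being the sum of its coefficients. *)
Lemma vmx_unit : vmx \in unitmx.
Proof.
rewrite -row_free_unit; apply: inj_row_free => u.
rewrite mulmx_sum_row => u0; apply/rowP => i; rewrite [RHS]mxE.
have e : \sum_i u 0 i *: vtx i = 0.
  by rewrite -[RHS]u0; apply: eq_bigr => j _; rewrite rowK.
apply: (hvt (c := fun i => u 0 i)).
- by rewrite -comb_vtx00 e mxE.
- by rewrite -comb_vtx_rsub e linear0.
Qed.

(* The dual basis of [vtx] for [mink]; [dual i] is normal to the facet opposite
   to [v i], and [mink X (dual i)] is the barycentric coordinate of [X]. *)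
Definition dual i : 'rV[R]_(1 + n) :=
  row_mx (invmx vmx 0 i)%:M (\row_k - invmx vmx (rshift 1 k) i).

(** The sign in the spatial part of [dual] cancels that of [mink]. *)
Lemma mink_dualE X i : mink X (dual i) = (X *m invmx vmx) 0 i.
Proof.
rewrite /mink /dual row_mxKr [RHS]mxE big_split_ord /= big_ord1.
have -> : lshift n (0 : 'I_1) = 0 by exact: val_inj.
congr (_ * _ + _).
  by rewrite row_mx00 mxE eqxx mulr1n.
by rewrite /dotp -sumrN; apply: eq_bigr => k _; rewrite !mxE mulrN opprK.
Qed.

Lemma vtx_dual i j : mink (vtx i) (dual j) = (i == j)%:R.
Proof.
rewrite mink_dualE -[vtx i](rowK vtx) -row_mul mulmxV ?vmx_unit //.
by rewrite !mxE.
Qed.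

Lemma dual_vtx i j : mink (dual i) (vtx j) = (i == j)%:R.
Proof. by rewrite minkC vtx_dual eq_sym. Qed.

Lemma decomp_vtx X : X = \sum_i mink X (dual i) *: vtx i.
Proof.
rewrite -[LHS](mulmxKV vmx_unit) mulmx_sum_row; apply: eq_bigr => i _.
by rewrite rowK mink_dualE.
Qed.

Lemma coord_comb a i : mink (\sum_j a j *: vtx j) (dual i) = a i.
Proof.
rewrite mink_suml (bigD1 i) //= minkZl vtx_dual eqxx mulr1 big1 ?addr0 //.
by move=> j ji; rewrite minkZl vtx_dual (negbTE ji) mulr0.
Qed.

Lemma mink_coord X Y : mink X Y = \sum_i mink X (dual i) * mink (vtx i) Y.
Proof.
by rewrite {1}(decomp_vtx X) mink_suml; apply: eq_bigr => i _; rewrite minkZl.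
Qed.

Lemma dual_inj X Y : (forall i, mink X (vtx i) = mink Y (vtx i)) -> X = Y.
Proof.
move=> h; rewrite (decomp_vtx X) (decomp_vtx Y); apply: eq_bigr => i _.
congr (_ *: _); rewrite !(minkC _ (dual i)) !(mink_coord (dual i)).
by apply: eq_bigr => j _; rewrite !(minkC (vtx j)) h.
Qed.

Lemma vtx_ge0 i j : 0 <= mink (vtx i) (vtx j).
Proof.
rewrite /vtx; have [->|/eqP ij] := eqVneq (v i) (v j); first by apply/hcompact_lift.
by apply: ltW; apply: mink_lift_gt0.
Qed.

Lemma vtx_gt0 i j : i != j -> 0 < mink (vtx i) (vtx j).
Proof.
move=> ij; apply: mink_lift_gt0 => // e.
have := vtx_dual i i; rewrite eqxx /vtx e -/(vtx j) vtx_dual.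
by rewrite eq_sym (negbTE ij) => /esym/eqP; rewrite oner_eq0.
Qed.

(** The normal is orthogonal to the sum of two other vertices, which is time-like even when both are
    ideal; it is nonzero since it pairs to 1 with [vtx i]. *)
Lemma dual_lt0 i : mink (dual i) (dual i) < 0.
Proof.
have [j [ji _]] := exists_third i i; have [k [ki kj]] := exists_third i j.
have T0 : 0 < mink (vtx j + vtx k) (vtx j + vtx k).
  rewrite !minkDl !minkDr; have := vtx_gt0 kj; have := vtx_ge0 j j.
  by have := vtx_ge0 k k; rewrite (minkC (vtx j) (vtx k)); lra.
have [|le0 eq0] := timelike_orth (X := dual i) T0.
  by rewrite minkDr !dual_vtx ![i == _]eq_sym (negbTE ji) (negbTE ki) addr0.
rewrite lt_neqAle le0 andbT; apply/eqP => /eq0 d0.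
by have := dual_vtx i i; rewrite d0 mink0l eqxx => /esym/eqP; rewrite oner_eq0.
Qed.

(** The length of the facet normal: for a future [X] with [mink X X = 1], [mink X (dual i) / wgt i]
    is the hyperbolic sine of the signed distance to the facet hyperplane. *)
Definition wgt i : R := Num.sqrt (- mink (dual i) (dual i)).

Lemma wgt_gt0 i : 0 < wgt i.
Proof. by rewrite sqrtr_gt0 oppr_gt0 dual_lt0. Qed.

Lemma dualE i : mink (dual i) (dual i) = - wgt i ^+ 2.
Proof. by rewrite sqr_sqrtr ?opprK // oppr_ge0 ltW // dual_lt0. Qed.

(** A weaker form of [timelike_orth] that also covers light-like vertices; Cauchy-Schwarz is used
    with [dotp (v i) (v i) <= 1]. *)
Lemma causal_orth X i : mink X (vtx i) = 0 -> mink X X <= 0.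
Proof.
rewrite /mink lift00 mulr1 rsub_lift => /eqP; rewrite subr_eq0 => /eqP ->.
have := dotp_CS (rsubmx X) (v i); have := dotp_ge0 (rsubmx X).
have : dotp (v i) (v i) <= 1.
  by have := vtx_ge0 i i; rewrite mink_lift subr_ge0.
rewrite subr_le0 -expr2 => h1 h2 h; apply: le_trans h _.
by rewrite ler_piMr.
Qed.

(* Both facet normals are orthogonal to a third vertex, a causal vector, whose
   orthogonal complement is negative semidefinite. *)
Lemma dual_ge i j : - (wgt i * wgt j) <= mink (dual i) (dual j).
Proof.
have [k [ki kj]] := exists_third i j.
have wi := wgt_gt0 i; have wj := wgt_gt0 j.
have : mink (wgt j *: dual i + - wgt i *: dual j)
            (wgt j *: dual i + - wgt i *: dual j) <= 0.
  apply: (causal_orth (i := k)); rewrite minkDl !minkZl !dual_vtx.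
  by rewrite ![_ == k]eq_sym (negbTE ki) (negbTE kj) !mulr0 addr0.
rewrite !minkDl !minkDr !minkZl !minkZr !dualE (minkC (dual j) (dual i)).
set b := mink _ _ => h; have ww : 0 < 2 * (wgt i * wgt j) by rewrite !mulr_gt0.
rewrite -(ler_pM2l ww) -subr_le0; apply: le_trans h.
by rewrite le_eqVlt; apply/orP; left; apply/eqP; ring.
Qed.

(** All ratios of a barycentric coordinate to [wgt] equal 1 here, so the point is equidistant from
    the facet hyperplanes. *)
Definition incenter : 'rV[R]_(1 + n) := \sum_i wgt i *: vtx i.

Local Notation Q := incenter.
Local Notation q := (mink Q Q).

Lemma incenter_dual i : mink Q (dual i) = wgt i.
Proof. exact: coord_comb. Qed.

Definition hgt i : R := mink (vtx i) Q.

Lemma hgt_gt0 i : 0 < hgt i.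
Proof.
have [j [ji _]] := exists_third i i.
rewrite /hgt mink_sumr (bigD1 j) //= minkZr ltr_pwDl //.
  by rewrite mulr_gt0 ?wgt_gt0 // vtx_gt0 // eq_sym.
by apply: sumr_ge0 => k _; rewrite minkZr mulr_ge0 ?vtx_ge0 // ltW // wgt_gt0.
Qed.

Lemma incenterE : q = \sum_i wgt i * hgt i.
Proof. by rewrite {1}/Q mink_suml; apply: eq_bigr => i _; rewrite minkZl. Qed.

Lemma incenter_gt0 : 0 < q.
Proof.
rewrite incenterE (bigD1 ord0) //= ltr_pwDl ?mulr_gt0 ?wgt_gt0 ?hgt_gt0 //.
by apply: sumr_ge0 => i _; rewrite ltW // mulr_gt0 ?wgt_gt0 ?hgt_gt0.
Qed.

Lemma incenter00 : 0 < Q 0 0.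
Proof.
rewrite comb_vtx00 (bigD1 ord0) //= ltr_pwDl ?wgt_gt0 //.
by apply: sumr_ge0 => i _; rewrite ltW // wgt_gt0.
Qed.

(** By independence the coefficients of a convex combination are the barycentric coordinates, so
    membership becomes a sign condition. *)
Lemma faceE (I : {set 'I_n.+1}) x : face v I x <->
  (forall i, 0 <= mink (lift x) (dual i)) /\
  (forall i, i \notin I -> mink (lift x) (dual i) = 0).
Proof.
split=> [[c [c0 c1 xE]]|[h0 hI]].
  have -> : lift x = \sum_i (if i \in I then c i else 0) *: vtx i.
    apply: lift_comb; first by rewrite -big_mkcond.
    rewrite xE big_mkcond; apply: eq_bigr => i _.
    by case: ifP; rewrite ?scale0r.
  by split=> i; rewrite coord_comb; case: ifP.
have hsum (E : zmodType) (F : 'I_n.+1 -> E) :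
    (forall i, i \notin I -> F i = 0) -> \sum_(i in I) F i = \sum_i F i.
  by move=> F0; rewrite big_mkcond; apply: eq_bigr => i _; case: ifPn => // /F0.
exists (fun i => mink (lift x) (dual i)); split=> //.
  by rewrite hsum // -comb_vtx00 -decomp_vtx lift00.
rewrite hsum => [|i iI]; last by rewrite hI // scale0r.
by rewrite -comb_vtx_rsub -decomp_vtx rsub_lift.
Qed.

Lemma skeleton_full x : skeleton v n x <->
  forall i, 0 <= mink (lift x) (dual i).
Proof.
split=> [[I /= _ /faceE[]] //|h].
exists [set: 'I_n.+1]; first by rewrite /= cardsT card_ord.
by apply/faceE; split=> // i; rewrite inE.
Qed.

Lemma skeleton_facets x : skeleton v n.-1 x <->
  (forall i, 0 <= mink (lift x) (dual i)) /\
  exists i, mink (lift x) (dual i) = 0.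
Proof.
have n1 : n.-1.+1 = n by rewrite prednK // (leq_trans _ hn).
split=> [[I /= cI /faceE[h0 hI]]|[h [i hi]]].
  split=> //; have /subsetPn[i _ iI] : ~~ ([set: 'I_n.+1] \subset I).
    by apply/negP => /subset_leq_card; rewrite cardsT card_ord cI n1 ltnn.
  by exists i; apply: hI.
exists (~: [set i]); first by rewrite /= cardsC1 card_ord.
by apply/faceE; split=> // j; rewrite !inE negbK => /eqP ->.
Qed.

Lemma lift_proj X : X 0 0 != 0 -> lift (proj X) = (X 0 0)^-1 *: X.
Proof. by move=> X0; rewrite -{3}(projK X0) scalerA mulVf // scale1r. Qed.

(* The foot of the perpendicular from [p] to the facet opposite to [v i] lies
   in that facet as soon as this facet is one of the nearest to [p]. *)
Lemma foot_in_facet p i : hspace p ->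
  (forall j, 0 <= mink (lift p) (dual j)) ->
  (forall j, mink (lift p) (dual i) / wgt i <= mink (lift p) (dual j) / wgt j) ->
  exists2 z, (skeleton v n.-1 `&` hspace)%classic z &
    hdist p z = acosh (Num.sqrt (1 + (mink (lift p) (dual i) / wgt i) ^+ 2 /
                                     mink (lift p) (lift p))).
Proof.
move=> hp p0 pmin; set P := lift p; set t := _ / wgt i.
have wi := wgt_gt0 i.
have PP : 0 < mink P P by rewrite -hspace_lift.
have t0 : 0 <= t by rewrite divr_ge0 // ltW.
have tE : mink P (dual i) = t * wgt i by rewrite divfK // gt_eqF.
(* The orthogonal projection of [P] to the facet hyperplane, as [dual i] has square
   [- wgt i ^+ 2]. *)
pose F := P + (t / wgt i) *: dual i.
have PF : mink P F = mink P P + t ^+ 2.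
  by rewrite minkDr minkZr tE; field; rewrite gt_eqF.
have FF : mink F F = mink P P + t ^+ 2.
  rewrite minkDl PF minkZl minkDr minkZr dualE (minkC (dual i)) tE.
  by field; rewrite gt_eqF.
have F00 : 0 < F 0 0.
  apply: (future_timelike PP); rewrite ?lift00 ?ltr01 //.
    by rewrite FF addr_ge0 ?sqr_ge0 // ltW.
  by rewrite minkC PF ltr_wpDr ?sqr_ge0.
have FF0 : 0 < mink F F by rewrite FF ltr_wpDr ?sqr_ge0.
(* Minimality gives [t * wgt j <= mink P (dual j)], and by [dual_ge] the correction term lowers this
   coordinate by at most [t * wgt j]. *)
have Fd j : 0 <= mink F (dual j).
  rewrite minkDl minkZl; have wj := wgt_gt0 j.
  have h1 : t * wgt j <= mink P (dual j) by rewrite -ler_pdivlMr.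
  have h2 : t / wgt i * - (wgt i * wgt j) <= t / wgt i * mink (dual i) (dual j).
    by apply: ler_wpM2l; rewrite ?dual_ge // divr_ge0 // ltW.
  have e : t / wgt i * - (wgt i * wgt j) = - (t * wgt j).
    by field; rewrite gt_eqF.
  by rewrite e in h2; lra.
exists (proj F).
  split; last by apply: hspace_proj => //; rewrite gt_eqF.
  apply/skeleton_facets; rewrite lift_proj ?gt_eqF //; split.
    by move=> j; rewrite minkZl mulr_ge0 // invr_ge0 ltW.
  exists i; rewrite minkZl minkDl minkZl tE dualE.
  by rewrite [X in _ * X](_ : _ = 0) ?mulr0 //; field; rewrite gt_eqF.
rewrite -{1}(liftK p) hdist_proj ?lift00 ?ltr01 //; congr acosh.
rewrite /chord PF FF; set x := _ + t ^+ 2.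
have x0 : 0 < x by rewrite ltr_wpDr ?sqr_ge0.
have -> : 1 + t ^+ 2 / mink P P = x ^+ 2 / (mink P P * x).
  by rewrite /x; field; rewrite !gt_eqF.
by rewrite [RHS]sqrtrM ?sqr_ge0 // sqrtr_sqr gtr0_norm // sqrtrV // mulr_ge0 // ltW.
Qed.

Lemma hdist_set_le p z (A : set 'rV[R]_n) : hspace p -> (A `&` hspace)%classic z ->
  hdist_set p A <= hdist p z.
Proof.
move=> hp Az; apply: ge_inf; last by exists z.
by exists 0 => _ [y [_ hy] <-]; apply: hdist_ge0.
Qed.

Definition inrad : R := acosh (Num.sqrt (1 + q^-1)).

(** If [z] lies on the [i]-th facet, adding [(wgt i)^-1 *: dual i] to the incenter keeps its product
    with [lift z] but raises its square from [q] to [q + 1]; the reverse Cauchy-Schwarz inequality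
    concludes. *)
Lemma hdist_incenter_ge z : (skeleton v n.-1 `&` hspace)%classic z ->
  inrad <= hdist (proj Q) z.
Proof.
move=> [/skeleton_facets[_ [i zi]] hz].
have q0 := incenter_gt0; have wi := wgt_gt0 i.
rewrite -{1}(liftK z) hdist_proj ?incenter00 ?lift00 ?ltr01 //.
have ZZ : 0 < mink (lift z) (lift z) by rewrite -hspace_lift.
have QZ : 0 < mink Q (lift z).
  have h : hcompact z by left.
  have hQ : hspace (proj Q) by apply: hspace_proj => //; rewrite gt_eqF // incenter00.
  have := mink_lift_in hQ h; rewrite lift_proj ?gt_eqF ?incenter00 //.
  by rewrite minkZl pmulr_rgt0 // invr_gt0 incenter00.
have qi : 0 <= q^-1 by rewrite invr_ge0 ltW.
apply: ler_acosh; first by rewrite -[leLHS]sqrtr1 ler_wsqrtr // lerDl.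
apply: chord_ge => //; first by rewrite addr_ge0.
have := mink_CS (Q + (wgt i)^-1 *: dual i) ZZ.
rewrite [in X in _ <= X]minkDl minkZl (minkC (dual i)) zi mulr0 addr0.
have -> : mink (Q + (wgt i)^-1 *: dual i) (Q + (wgt i)^-1 *: dual i) = q + 1.
  rewrite minkDl !minkDr !minkZl !minkZr dualE (minkC (dual i)) incenter_dual.
  by field; rewrite gt_eqF.
by apply: le_trans; rewrite le_eqVlt; apply/orP; left; apply/eqP; field; rewrite gt_eqF.
Qed.

Lemma inrad_is_inradius : is_inradius v inrad.
Proof.
have q0 := incenter_gt0; have Q0 := incenter00.
have Q0n : Q 0 0 != 0 by rewrite gt_eqF.
have hQ : hspace (proj Q) by apply: hspace_proj.
have coordQ i : mink (lift (proj Q)) (dual i) = (Q 0 0)^-1 * wgt i.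
  by rewrite lift_proj // minkZl incenter_dual.
have coordQ0 i : 0 <= mink (lift (proj Q)) (dual i).
  by rewrite coordQ ltW // mulr_gt0 ?invr_gt0 ?wgt_gt0.
split.
  exists (proj Q); first by split=> //; apply/skeleton_full.
  have [|z Az zE] := foot_in_facet (i := ord0) hQ coordQ0.
    by move=> j; rewrite !coordQ !mulfK // gt_eqF // wgt_gt0.
  apply/eqP; rewrite eq_le; apply/andP; split.
    apply: le_trans (hdist_set_le hQ Az) _; rewrite zE coordQ mulfK; last first.
      by rewrite gt_eqF // wgt_gt0.
    rewrite lift_proj // minkZl minkZr /inrad.
    rewrite (_ : _ / (_ * _) = q^-1) //; field; rewrite Q0n gt_eqF //.
  apply: lb_le_inf; first by exists (hdist (proj Q) z), z.
  by move=> _ [y Ay <-]; apply: hdist_incenter_ge.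
move=> _ [p [/skeleton_full p0 hp] <-].
pose f i := mink (lift p) (dual i) / wgt i.
(* The smallest ratio selects a facet nearest to [p], which contains the foot of the
   perpendicular. *)
have [i _ imin] := @arg_minP _ _ _ ord0 xpredT f isT.
have [j|z Az zE] := foot_in_facet (i := i) hp p0; first exact: imin.
apply: le_trans (hdist_set_le hp Az) _; rewrite {}zE.
set t := _ / wgt i; set pp := mink _ _.
have PP : 0 < pp by rewrite /pp -hspace_lift.
have t0 : 0 <= t by rewrite divr_ge0 // ltW // wgt_gt0.
have h : t ^+ 2 * q <= pp.
  rewrite /pp (decomp_vtx (lift p)) !mink_suml mulr_sumr.
  apply: ler_sum => j _; rewrite !mink_sumr mulr_sumr; apply: ler_sum => k _.
  rewrite !minkZl !minkZr.
  have tw l : t * wgt l <= mink (lift p) (dual l).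
    by rewrite -ler_pdivlMr ?wgt_gt0 //; apply: imin.
  have tw0 l : 0 <= t * wgt l by rewrite mulr_ge0 // ltW // wgt_gt0.
  have := ler_pM (tw0 j) (tw0 k) (tw j) (tw k).
  move=> /(ler_wpM2r (vtx_ge0 j k)); clearbody t; rewrite !mulrA; apply: le_trans.
  by rewrite le_eqVlt; apply/orP; left; apply/eqP; ring.
apply: ler_acosh.
  by rewrite -[leLHS]sqrtr1 ler_wsqrtr // lerDl divr_ge0 ?sqr_ge0 // ltW.
rewrite ler_wsqrtr // lerD2l ler_pdivrMr // mulrC ler_pdivlMr //.
Qed.

End Simplex.

(** * The lower bound on the square of the incenter and its equality case *)

Section Bound.
Context {R : realType} {n : nat} (v : 'I_n.+1 -> 'rV[R]_n).
Hypotheses (hn : (2 <= n)%N) (hv : simplex v) (hvt : total_simplex v).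
Implicit Types (i j k : 'I_n.+1) (m : 'I_n.+1 -> R).

Local Notation Q := (incenter v).
Local Notation q := (mink Q Q).
Local Notation V := (vtx v).
Local Notation U := (dual v).
Local Notation w := (wgt v).
Local Notation h := (hgt v).
Local Notation s := (Num.sqrt (q + 1)).

(** The Gram matrix of the rescaled vertices [(m i)^-1 *: V i] has 0 on the diagonal and 1
    elsewhere. *)
Definition balanced m : Prop :=
  forall i j, mink (V i) (V j) = (i != j)%:R * (m i * m j).

Let q0 : 0 < q. Proof. exact: incenter_gt0. Qed.
Let w0 i : 0 < w i. Proof. exact: wgt_gt0. Qed.
Let h0 i : 0 < h i. Proof. exact: hgt_gt0. Qed.

Lemma sqr_sqrt_incenter : s ^+ 2 = q + 1.
Proof. by rewrite sqr_sqrtr // addr_ge0 // ltW. Qed.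

Lemma sqrt_incenter_gt1 : 1 < s.
Proof. by rewrite -[ltLHS]sqrtr1 ltr_sqrt ?ltrDr //; apply: ltr_wpDl => //; apply: ltW. Qed.

(* With this choice of coefficients the vector is orthogonal to the incenter,
   and it vanishes exactly in the ideal regular case. *)
Definition defect i : 'rV[R]_(1 + n) :=
  U i + (s * w i / h i) *: V i + (- (w i / (s - 1))) *: Q.

(** The product is [w i + s * w i - w i * q / (s - 1)], and [q = (s - 1) * (s + 1)]. *)
Lemma defect_orth i : mink (defect i) Q = 0.
Proof.
have s1 := sqrt_incenter_gt1; rewrite !minkDl !minkZl (minkC (U i)) incenter_dual // -/(h i).
have qE : (s - 1) * (s + 1) = q by rewrite -subr_sqr_1 sqr_sqrt_incenter addrK.
move: s1 qE; set t := Num.sqrt _ => s1 <-.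
by field; rewrite subr_eq0 !gt_eqF.
Qed.

Lemma defect_sqr i : mink (defect i) (defect i) =
  2 * (s * w i / h i) *
    (1 + s * w i / h i / 2 * mink (V i) (V i) - w i * h i / (s - 1)).
Proof.
have s1 := sqrt_incenter_gt1; have hi := h0 i.
rewrite {2}/defect minkDr minkZr defect_orth mulr0 addr0 /defect.
rewrite !minkDl !minkDr !minkZl !minkZr !(minkC Q (V i)) -!/(h i).
rewrite incenter_dual // dual_vtx // vtx_dual // eqxx dualE // mulr1n.
by field; rewrite subr_eq0 !gt_eqF.
Qed.

Lemma defect_le i : s * w i / h i / 2 * mink (V i) (V i) <= w i * h i / (s - 1) - 1.
Proof.
have [+ _] := timelike_orth q0 (defect_orth i).
have s1 := sqrt_incenter_gt1; rewrite defect_sqr pmulr_rle0; first by lra.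
by rewrite mulr_gt0 // divr_gt0 // mulr_gt0 // (lt_trans ltr01).
Qed.

Lemma sum_defect : \sum_i (w i * h i / (s - 1) - 1) = s - n%:R.
Proof.
rewrite big_split /= -mulr_suml -incenterE sumr_const card_ord.
have qE : (s - 1) * (s + 1) = q by rewrite -subr_sqr_1 sqr_sqrt_incenter addrK.
move: sqrt_incenter_gt1 qE; set t := Num.sqrt _ => s1 <-.
by rewrite -addn1 mulrnDr mulNrn; field; rewrite subr_eq0 gt_eqF.
Qed.

Lemma defect_ge0 i : 0 <= w i * h i / (s - 1) - 1.
Proof.
apply: le_trans (defect_le i).
by rewrite mulr_ge0 ?vtx_ge0 // !divr_ge0 ?mulr_ge0 ?sqrtr_ge0 // ltW.
Qed.

Lemma incenter_ge : n%:R ^+ 2 - 1 <= q.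
Proof.
rewrite lerBlDr -sqr_sqrt_incenter lerXn2r ?nnegrE ?ler0n ?sqrtr_ge0 //.
by rewrite -subr_ge0 -sum_defect sumr_ge0 // => i _; apply: defect_ge0.
Qed.

Lemma incenter_eq_balanced : q = n%:R ^+ 2 - 1 ->
  exists2 m, forall i, 0 < m i & balanced m.
Proof.
move=> qE; have s1 := sqrt_incenter_gt1.
have sn : s = n%:R by rewrite qE subrK sqrtr_sqr ger0_norm.
have d0 i : w i * h i / (s - 1) - 1 = 0.
  have := sum_defect; rewrite [in RHS]sn subrr => /eqP.
  rewrite psumr_eq0; last by move=> j _; apply: defect_ge0.
  by move=> /allP/(_ i (mem_index_enum i))/= /eqP.
have sp : 0 < s by apply: lt_trans s1.
have l0 i : 0 < s * w i / h i by rewrite divr_gt0 // mulr_gt0.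
have Bii i : mink (V i) (V i) = 0.
  have := defect_le i; rewrite d0 pmulr_rle0 ?(divr_gt0 (l0 i)) // => le0.
  by apply/eqP; rewrite eq_le le0 vtx_ge0.
have E0 i : defect i = 0.
  have [_] := timelike_orth q0 (defect_orth i); apply.
  by have := d0 i; rewrite defect_sqr Bii mulr0 => e; rewrite (_ : _ - _ = 0) ?mulr0; lra.
(* Pairing [defect i = 0] with [V j] gives [mink (V i) (V j) = h i * h j / (s * (s - 1))], whence
   [m i = h i / c]. *)
pose c := Num.sqrt (s * (s - 1)).
have c0 : 0 < c by rewrite sqrtr_gt0 mulr_gt0 //; lra.
have c2 : c ^+ 2 = s * (s - 1) by rewrite sqr_sqrtr // mulr_ge0 //; lra.
exists (fun i => h i / c) => [i|i j]; first by rewrite divr_gt0.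
have [<-|ij] := eqVneq i j; first by rewrite Bii mul0r.
rewrite mul1r; have : mink (defect i) (V j) = 0 by rewrite E0 mink0l.
rewrite !minkDl !minkZl dual_vtx // (negbTE ij) (minkC Q) -/(h j) add0r.
move=> /eqP; rewrite mulNr subr_eq0 => /eqP e.
apply: (mulfI (lt0r_neq0 (l0 i))); rewrite e mulf_div -expr2 c2.
by field; rewrite subr_eq0 !gt_eqF // (lt_trans ltr01).
Qed.

Lemma sum_neq k : \sum_i (i != k)%:R = n%:R :> R.
Proof.
rewrite (bigD1 k) //= eqxx add0r (eq_bigr (fun=> 1)); last by move=> i ->.
by rewrite sumr_const cardC1 card_ord.
Qed.

(** The vector [S] makes the dual basis explicit, which yields [w i = c / m i] with
    [c ^+ 2 = 1 - 1/n]. Hence [Q = c *: S], and the square of [S] is [(n + 1) * n]. *)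
Lemma balanced_incenter m : (forall i, 0 < m i) -> balanced m ->
  q = n%:R ^+ 2 - 1.
Proof.
move=> m0 mB; have mn i : m i != 0 by rewrite gt_eqF.
have n0 : n%:R != 0 :> R by rewrite pnatr_eq0 -lt0n (leq_trans _ hn).
pose S := \sum_j (m j)^-1 *: V j.
have SV k : mink S (V k) = n%:R * m k.
  rewrite mink_suml -(sum_neq k) mulr_suml; apply: eq_bigr => j _.
  by rewrite minkZl mB mulrCA mulKf.
have UE i : U i = (m i)^-1 *: (n%:R^-1 *: S + (- (m i)^-1) *: V i).
  apply: (dual_inj hvt) => k.
  rewrite dual_vtx // minkZl minkDl !minkZl SV mB.
  by case: eqVneq => [<-|ik]; rewrite /= ?mulr1n ?mulr0n; field; rewrite n0 mn.
pose c := Num.sqrt (1 - n%:R^-1 : R).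
have c0 : 0 <= (1 - n%:R^-1 : R).
  by rewrite subr_ge0 invf_le1 ?ltr0n ?ler1n ?(leq_trans _ hn).
have wE i : w i = c / m i.
  rewrite /wgt {1}UE minkZl minkDl !minkZl vtx_dual // eqxx mulr1n.
  rewrite (_ : mink S (U i) = (m i)^-1); last first.
    by rewrite /S coord_comb.
  rewrite (_ : - _ = (1 - n%:R^-1) * ((m i)^-1 ^+ 2)); last by field; rewrite n0 mn.
  by rewrite sqrtrM // sqrtr_sqr ger0_norm // invr_ge0 ltW.
have QE : Q = c *: S.
  by rewrite /incenter /S scaler_sumr; apply: eq_bigr => i _; rewrite wE scalerA.
rewrite {1}QE minkZl QE minkZr {1}/S mink_suml.
rewrite (eq_bigr (fun=> n%:R)); last first.
  by move=> i _; rewrite minkZl minkC SV mulrCA mulVf ?mulr1.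
rewrite sumr_const card_ord mulrSr -[n%:R *+ n]mulr_natr mulrA -expr2 sqr_sqrtr //.
by field.
Qed.

(** With [x = n] and [z = (x^2 - 1)^(-1/2)], the argument [(x + 1) / (x - 1)] of the logarithm in
    [atanh] is the square of [x * z + z], the one in [acosh]. *)
Lemma atanh_acosh : atanh (1 / n%:R) =
  acosh (Num.sqrt (1 + (n%:R ^+ 2 - 1)^-1)) :> R.
Proof.
have n2 : 2 <= n%:R :> R by rewrite ler_nat.
set x : R := n%:R in n2 *; rewrite /atanh /acosh.
have y0 : 0 < x ^+ 2 - 1 by nra.
have e1 : 0 <= 1 + (x ^+ 2 - 1)^-1 by rewrite addr_ge0 // invr_ge0 ltW.
rewrite sqr_sqrtr // (_ : 1 + (x ^+ 2 - 1)^-1 - 1 = (x ^+ 2 - 1)^-1); last by ring.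
have -> : 1 + (x ^+ 2 - 1)^-1 = x ^+ 2 * (x ^+ 2 - 1)^-1.
  by field; rewrite gt_eqF.
rewrite sqrtrM ?sqr_ge0 // sqrtr_sqr ger0_norm; last by lra.
set z := Num.sqrt _; have z0 : 0 < z by rewrite sqrtr_gt0 invr_gt0.
have z2 : z ^+ 2 = (x ^+ 2 - 1)^-1 by rewrite sqr_sqrtr // invr_ge0 ltW.
have -> : (1 + 1 / x) / (1 - 1 / x) = (x * z + z) ^+ 2.
  rewrite (_ : x * z + z = (x + 1) * z); last by ring.
  rewrite exprMn z2; field.
  by rewrite -/x; apply/and3P; split; rewrite gt_eqF //; lra.
have xz : 0 < x * z + z by rewrite addr_gt0 // mulr_gt0 //; lra.
by rewrite lnXn // mulr2n; field.
Qed.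

Lemma inrad_le : inrad v <= atanh (1 / n%:R).
Proof.
have n2 : 2 <= n%:R :> R by rewrite ler_nat.
have y0 : 0 < n%:R ^+ 2 - 1 :> R by nra.
have qi : 0 <= q^-1 by rewrite invr_ge0 ltW.
rewrite atanh_acosh; apply: ler_acosh.
  by rewrite -[leLHS]sqrtr1 ler_wsqrtr // lerDl.
by rewrite ler_wsqrtr // lerD2l lef_pV2 ?posrE // incenter_ge.
Qed.

Lemma inrad_eq : inrad v = atanh (1 / n%:R) <-> q = n%:R ^+ 2 - 1.
Proof.
have n2 : 2 <= n%:R :> R by rewrite ler_nat.
have y0 : 0 <= (n%:R ^+ 2 - 1)^-1 :> R by rewrite invr_ge0; nra.
have qi : 0 <= q^-1 by rewrite invr_ge0 ltW.
rewrite atanh_acosh /inrad; split=> [|-> //] /acosh_inj e.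
apply: invr_inj; apply: (addrI 1).
apply/eqP; rewrite -eqr_sqrt ?addr_ge0 //; apply/eqP; apply: e.
  by rewrite -[leLHS]sqrtr1 ler_wsqrtr // lerDl.
by rewrite -[leLHS]sqrtr1 ler_wsqrtr // lerDl.
Qed.

End Bound.

(** * Linear isometries acting on the ball, and cross-ratios as isometry invariants *)

Section Isometries.
Context {R : realType} {n : nat}.
Implicit Types (x y z t : 'rV[R]_n) (X Y : 'rV[R]_(1 + n)) (A B : 'M[R]_(1 + n)).

(** Positivity on the whole closed ball keeps the denominator in [proj_map] nonzero up to the
    boundary, where continuity is needed. *)
Definition orthochronous A : Prop :=
  (forall X Y, mink (X *m A) (Y *m A) = mink X Y) /\
  (forall x, hcompact x -> 0 < (lift x *m A) 0 0).

Definition proj_map A x : 'rV[R]_n := proj (lift x *m A).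

Lemma mulmxr_continuous p k (D : 'M[R]_(p, k)) :
  continuous (fun u : 'rV[R]_p => u *m D).
Proof.
have -> : (fun u : 'rV[R]_p => u *m D) = fun u => \sum_i u 0 i *: row i D.
  by apply/funext => u; rewrite mulmx_sum_row.
apply: continuous_big => [|i _]; first exact: add_continuous.
by move=> u; apply: continuousZr_tmp; apply: coord_continuous.
Qed.

Lemma lift_mulmx_continuous A : continuous (fun x => lift x *m A).
Proof.
have -> : (fun x => lift x *m A) = fun x => (1%:M *m usubmx A) + x *m dsubmx A.
  by apply/funext => x; rewrite -{1}(vsubmxK A) mul_row_col.
move=> x; apply: (@continuousD _ _ _ (fun=> _) (mulmxr (dsubmx A))).
  exact: (@cst_continuous _ _ (1%:M *m usubmx A)).
exact: mulmxr_continuous.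
Qed.

Lemma proj_map_continuous A x : (lift x *m A) 0 0 != 0 ->
  {for x, continuous (proj_map A)}.
Proof.
move=> A0; apply: continuousZ.
  apply: continuousV => //.
  apply: (@continuous_comp _ _ _ (fun x => lift x *m A) (fun X => X 0 0)).
    exact: lift_mulmx_continuous.
  exact: coord_continuous.
apply: (@continuous_comp _ _ _ (fun x => lift x *m A) (fun X => rsubmx X)).
  exact: lift_mulmx_continuous.
exact: continuous_rsubmx.
Qed.

Lemma orthochronous_hspace A x : orthochronous A -> hspace x ->
  hspace (proj_map A x).
Proof.
move=> [AB A0] hx; apply: hspace_proj; first by rewrite AB -hspace_lift.
by rewrite gt_eqF // A0 //; left.
Qed.

Lemma orthochronous_isometry A B : orthochronous A -> orthochronous B ->
  B *m A = 1%:M -> hisometry (proj_map A).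
Proof.
move=> oA oB BA; have [AB A0] := oA; have [_ B0] := oB; split.
- apply/seteqP; split=> [_ [x hx <-]|y hy].
    exact: orthochronous_hspace.
  exists (proj_map B y); first exact: orthochronous_hspace.
  have y0 : (lift y *m B) 0 0 != 0 by rewrite gt_eqF // B0 //; left.
  rewrite /proj_map lift_proj // -scalemxAl projZ ?invr_eq0 //.
  by rewrite -mulmxA BA mulmx1 liftK.
- move=> x y hx hy; rewrite hdist_proj ?A0 //; try by left.
  by rewrite hdistE /chord !AB.
apply: continuous_in_subspaceT => x; rewrite inE => hx.
by apply: proj_map_continuous; rewrite gt_eqF // A0.
Qed.

Lemma hisometry_chord g x y : hisometry g -> hspace x -> hspace y ->
  chord (lift (g x)) (lift (g y)) = chord (lift x) (lift y).
Proof.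
move=> [gs gd _] hx hy.
have gh z : hspace z -> hspace (g z) by move=> hz; rewrite -gs; exists z.
apply: acosh_inj; rewrite -?hdistE ?gd //.
  by apply: chord_lift_ge1; apply: gh.
exact: chord_lift_ge1.
Qed.

Lemma mink_chord x y : hspace x -> hspace y ->
  mink (lift x) (lift y) = chord (lift x) (lift y) *
    (Num.sqrt (mink (lift x) (lift x)) * Num.sqrt (mink (lift y) (lift y))).
Proof.
rewrite !hspace_lift => hx hy.
by rewrite -sqrtrM ?ltW // divfK // gt_eqF // sqrtr_gt0 mulr_gt0.
Qed.

Local Notation b x y := (mink (lift x) (lift y)).

(** Each product is an invariant [chord] times one square root per point, and both sides contain the
    same square roots. *)
Lemma hisometry_cross_in g x y z t : hisometry g ->
  hspace x -> hspace y -> hspace z -> hspace t ->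
  b (g x) (g y) * b (g z) (g t) * (b x z * b y t) =
  b x y * b z t * (b (g x) (g z) * b (g y) (g t)).
Proof.
move=> hg hx hy hz ht.
have gh u : hspace u -> hspace (g u) by move=> hu; case: hg => <- _ _; exists u.
rewrite [b (g x) (g y)]mink_chord ?[b (g z) (g t)]mink_chord; try exact: gh.
rewrite [b (g x) (g z)]mink_chord ?[b (g y) (g t)]mink_chord; try exact: gh.
rewrite [b x y]mink_chord ?[b z t]mink_chord //.
rewrite [b x z]mink_chord ?[b y t]mink_chord //.
rewrite !(hisometry_chord hg) //; ring.
Qed.

Local Open Scope classical_set_scope.

Lemma mink_lift_cvg (u v : nat -> 'rV[R]_n) x y :
  u @ \oo --> x -> v @ \oo --> y ->
  (fun k => b (u k) (v k)) @ \oo --> b x y.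
Proof.
move=> ux vy; under eq_fun do rewrite mink_lift; rewrite mink_lift.
apply: cvgB; first exact: cvg_cst.
apply: cvg_big => [|i _]; first exact: add_continuous.
apply: cvgM.
  exact: (cvg_comp _ _ ux (@coord_continuous _ _ _ 0 i x)).
exact: (cvg_comp _ _ vy (@coord_continuous _ _ _ 0 i y)).
Qed.

(** A radial approximation from inside the ball: the factor is [1 - 1/(k+1)], equal to 0 at [k = 0]
    and always below 1. *)
Definition shrink x (k : nat) : 'rV[R]_n := (1 - harmonic k) *: x.

Lemma shrink_cvg x : shrink x @ \oo --> x.
Proof.
rewrite -[X in _ --> X]scale1r -[X in X *: x]subr0; apply: cvgZr_tmp.
by apply: cvgB; [exact: cvg_cst|exact: cvg_harmonic].
Qed.

Lemma shrink_hspace x k : hcompact x -> hspace (shrink x k).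
Proof.
rewrite hcompact_lift hspace_lift !mink_lift /shrink dotpZl dotpC dotpZl => x1.
have h0 : 0 < (harmonic k : R) by rewrite invr_gt0.
have h1 : (harmonic k : R) <= 1 by rewrite invf_le1 ?ler1n.
have := dotp_ge0 x; set d := dotp x x in x1 *; set e := harmonic k in h0 h1 * => d0.
have a0 : 0 <= 1 - e by lra.
have a1 : (1 - e) * d <= 1 - e by rewrite ler_piMr //; lra.
have : (1 - e) * ((1 - e) * d) <= (1 - e) by rewrite ler_piMr // ; lra.
lra.
Qed.

Lemma hisometry_shrink_cvg g x : hisometry g -> hcompact x ->
  g (shrink x k) @[k --> \oo] --> g x.
Proof.
move=> [_ _ /subspace_continuousP gc] hx.
apply: (cvg_comp (shrink x) g _ (gc x hx)) => P.
rewrite /within /= => Px.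
have h : \forall k \near \oo, hcompact (shrink x k) -> P (shrink x k).
  exact: shrink_cvg Px.
by apply: filterS h => k; apply; left; apply: shrink_hspace.
Qed.

(* Cross-ratios of products of lifts do not depend on how the points are
   lifted, hence are isometry invariants, also at infinity by continuity. *)
Lemma hisometry_cross g x y z t : hisometry g ->
  hcompact x -> hcompact y -> hcompact z -> hcompact t ->
  b (g x) (g y) * b (g z) (g t) * (b x z * b y t) =
  b x y * b z t * (b (g x) (g z) * b (g y) (g t)).
Proof.
move=> hg hx hy hz ht.
have clim (h : 'rV[R]_n -> 'rV[R]_n) (p q : 'rV[R]_n) :
    (forall u, hcompact u -> h (shrink u k) @[k --> \oo] --> h u) ->
    hcompact p -> hcompact q ->
    (fun k => b (h (shrink p k)) (h (shrink q k))) @ \oo --> b (h p) (h q).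
  by move=> hc hp hq; apply: mink_lift_cvg; apply: hc.
have cg u := @hisometry_shrink_cvg g u hg.
have ci u : hcompact u -> id (shrink u k) @[k --> \oo] --> id u.
  by move=> _; apply: shrink_cvg.
have c1 := cvgM (cvgM (clim g x y cg hx hy) (clim g z t cg hz ht))
                (cvgM (clim id x z ci hx hz) (clim id y t ci hy ht)).
have c2 := cvgM (cvgM (clim id x y ci hx hy) (clim id z t ci hz ht))
                (cvgM (clim g x z cg hx hz) (clim g y t cg hy ht)).
rewrite -(cvg_lim (@norm_hausdorff R R) (c1 _ _ _)).
rewrite -(cvg_lim (@norm_hausdorff R R) (c2 _ _ _)).
(* Both limits are taken along sequences that agree term by term, by the interior case. *)
congr (lim (_ @ \oo)); apply/funext => k.
by apply: hisometry_cross_in => //; apply: shrink_hspace.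
Qed.

End Isometries.

(** If [b i j = m i * m j], then [b o i * b o j / b i j] is [(m o)^2]. The cross-ratio condition
    makes this quotient constant off the diagonal and away from [o], and its square root serves as
    [m o]. *)
Lemma rank_one_off_diag (R : realType) (I : finType) (b : I -> I -> R) (o p p' : I) :
  p != o -> p' != o -> p != p' ->
  (forall i j, b i j = b j i) -> (forall i j, i != j -> 0 < b i j) ->
  (forall i j k l, uniq [:: i; j; k; l] -> b i k * b j l = b i j * b k l) ->
  exists2 m : I -> R, forall i, 0 < m i & forall i j, i != j -> b i j = m i * m j.
Proof.
move=> po p'o pp' bC b0 bx.
pose f i j := b o i * b o j / b i j.
have fC i j : f i j = f j i by rewrite /f (bC j i) (mulrC (b o j)).
have fE i j k : i != o -> j != o -> k != o -> i != j -> k != j -> f i j = f k j.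
  move=> io jo ko ij kj; have [->//|ik] := eqVneq i k.
  have bij := lt0r_neq0 (b0 _ _ ij); have bkj := lt0r_neq0 (b0 _ _ kj).
  apply/eqP; rewrite /f eqr_div // mulrAC [X in _ == X]mulrAC; apply/eqP.
  congr (_ * _); apply: bx; rewrite /= !inE !negb_or !(eq_sym o).
  by rewrite ko io jo [k == i]eq_sym ik kj ij.
have fc i j : i != o -> j != o -> i != j -> f i j = f p p'.
  (* One index is exchanged at a time; [j = p] is treated apart so that the two indices never
     coincide. *)
  move=> io jo ij; have [jp|jp] := eqVneq j p.
    by rewrite -jp in pp' po *; rewrite (fE i j p') // ?fC // eq_sym.
  rewrite (fE i j p) //; last by rewrite eq_sym.
  by rewrite fC (fE j p p') // ?[f p' p]fC // eq_sym.
have op : o != p by rewrite eq_sym.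
have op' : o != p' by rewrite eq_sym.
have c0 : 0 < f p p' by rewrite divr_gt0 ?mulr_gt0 ?b0.
pose r := Num.sqrt (f p p'); have r0 : 0 < r by rewrite sqrtr_gt0.
have r2 : r ^+ 2 = f p p' by rewrite sqr_sqrtr // ltW.
exists (fun i => if i == o then r else b o i / r) => [i|i j ij].
  by case: ifPn => // io; rewrite divr_gt0 // b0 // eq_sym.
have [io|io] := eqVneq i o; have [jo|jo] := eqVneq j o.
- by rewrite io jo eqxx in ij.
- by rewrite io mulrC divfK // gt_eqF.
- by rewrite jo divfK ?gt_eqF.
rewrite mulf_div -expr2 r2 -(fc i j) // /f invf_div mulrC divfK //.
by rewrite mulf_neq0 // gt_eqF // b0 // eq_sym.
Qed.

(** * Balanced simplices are the ideal regular ones *)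

Section Regular.
Context {R : realType} {n : nat} (v : 'I_n.+1 -> 'rV[R]_n).
Hypotheses (hn : (2 <= n)%N) (hv : simplex v) (hvt : total_simplex v).
Implicit Types (i j k : 'I_n.+1) (m : 'I_n.+1 -> R) (s : 'S_n.+1).

Local Notation V := (vtx v).
Local Notation U := (dual v).

Lemma balanced_of_regular : ideal_simplex v -> regular_simplex v ->
  exists2 m, forall i, 0 < m i & balanced v m.
Proof.
move=> vi vr; pose b i j := mink (V i) (V j).
have [p [po _]] := exists_third hn ord0 ord0.
have [p' [p'o p'p]] := exists_third hn ord0 p.
have [||||m m0 mE] := @rank_one_off_diag R _ b ord0 p p' po p'o.
- by rewrite eq_sym.
- by move=> i j; apply: minkC.
- by move=> i j; apply: vtx_gt0.
- move=> i j k l; rewrite /= !inE !negb_or.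
  move=> /and4P[/and3P[ij ik il] /andP[jk jl] kl _].
  (* Exchanging [j] and [k] inverts the cross-ratio, so its square is 1; nonnegativity of the
     products removes the square. *)
  have [g hg gv] := vr (tperm j k).
  have := hisometry_cross hg (hv i) (hv j) (hv k) (hv l).
  rewrite !gv tpermL tpermR !tpermD // 1?eq_sym // => e.
  have ik0 : 0 <= b i k * b j l by rewrite mulr_ge0 ?vtx_ge0.
  have ij0 : 0 <= b i j * b k l by rewrite mulr_ge0 ?vtx_ge0.
  by apply/eqP; rewrite -(eqrXn2 (n := 2)) // !expr2; apply/eqP.
exists m => // i j; case: eqVneq => [<-|ij]; last by rewrite mul1r; apply: mE.
by rewrite mul0r; apply/hboundary_lift.
Qed.

Section Balanced.
Variable m : 'I_n.+1 -> R.
Hypotheses (m0 : forall i, 0 < m i) (mB : balanced v m).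

Let mn i : m i != 0. Proof. by rewrite gt_eqF. Qed.

(** The factors are chosen so that the rescaled vertices [(m i)^-1 *: V i] are permuted exactly. *)
Definition perm_vtx s : 'M[R]_(1 + n) :=
  invmx (vmx v) *m \matrix_i ((m i / m (s i)) *: V (s i)).

Lemma vtx_perm i s : V i *m perm_vtx s = (m i / m (s i)) *: V (s i).
Proof.
by rewrite -[V i](rowK V) mulmxA -row_mul mulmxV ?vmx_unit // -row_mul mul1mx rowK.
Qed.

Lemma mulmx_perm X s :
  X *m perm_vtx s = \sum_i mink X (U i) *: ((m i / m (s i)) *: V (s i)).
Proof.
rewrite {1}(decomp_vtx hvt X) mulmx_suml; apply: eq_bigr => i _.
by rewrite -scalemxAl vtx_perm.
Qed.

Lemma perm_vtx_mink X Y s :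
  mink (X *m perm_vtx s) (Y *m perm_vtx s) = mink X Y.
Proof.
rewrite !mulmx_perm mink_suml (mink_coord hvt X); apply: eq_bigr => i _.
rewrite minkZl; congr (_ * _); rewrite mink_sumr minkC (mink_coord hvt Y).
apply: eq_bigr => j _; rewrite minkZr; congr (_ * _).
rewrite minkZl minkZr !mB (inj_eq perm_inj) eq_sym; field.
by rewrite !mn.
Qed.

Lemma perm_vtxV s : perm_vtx s *m perm_vtx s^-1 = 1%:M.
Proof.
apply: (can_inj (mulKmx (vmx_unit hvt))); rewrite mulmx1 mulmxA.
apply/row_matrixP => i; rewrite !row_mul rowK vtx_perm -scalemxAl vtx_perm permK.
by rewrite scalerA (_ : _ * _ = 1) ?scale1r //; field; rewrite !mn.
Qed.

(** A future time-like vector fixed by every [perm_vtx s], used to test time orientation. *)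
Definition center : 'rV[R]_(1 + n) := \sum_j (m j)^-1 *: V j.

Lemma center_vtx k : mink center (V k) = n%:R * m k.
Proof.
rewrite mink_suml -(sum_neq k) mulr_suml; apply: eq_bigr => j _.
by rewrite minkZl mB mulrCA mulKf.
Qed.

Lemma center_gt0 : 0 < mink center center.
Proof.
rewrite {1}/center mink_suml big_ord_recl ltr_pwDl //.
  rewrite minkZl minkC center_vtx !mulr_gt0 ?invr_gt0 // ltr0n.
  exact: leq_trans hn.
apply: sumr_ge0 => i _; rewrite minkZl minkC center_vtx.
by rewrite !mulr_ge0 ?invr_ge0 // ltW.
Qed.

Lemma center00 : 0 < center 0 0.
Proof.
rewrite comb_vtx00 big_ord_recl ltr_pwDl ?invr_gt0 //.
by apply: sumr_ge0 => i _; rewrite invr_ge0 ltW.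
Qed.

Lemma center_perm s : center *m perm_vtx s = center.
Proof.
rewrite mulmx_suml [RHS](reindex_inj (perm_inj (s := s))); apply: eq_bigr => i _.
by rewrite -scalemxAl vtx_perm scalerA mulrA mulVf // mul1r.
Qed.

(** As [center] is fixed, the image of a lifted point has the same positive product with it as the
    point itself, and [future_timelike] applies. *)
Lemma perm_vtx_orthochronous s : orthochronous (perm_vtx s).
Proof.
split=> [X Y|x hx]; first exact: perm_vtx_mink.
apply: (future_timelike center_gt0 center00).
  by rewrite perm_vtx_mink; apply/hcompact_lift.
rewrite -{1}(center_perm s) perm_vtx_mink.
have c0 := center00; rewrite -(projK (lt0r_neq0 c0)) minkZr pmulr_rgt0 // minkC.
by apply: mink_lift_in => //; apply: hspace_proj; rewrite ?center_gt0 // gt_eqF.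
Qed.

Lemma balanced_ideal_regular : ideal_simplex v /\ regular_simplex v.
Proof.
split=> [i|s]; first by apply/hboundary_lift; rewrite -/(V i) mB eqxx mul0r.
exists (proj_map (perm_vtx s)) => [|i].
  apply: (@orthochronous_isometry _ _ _ (perm_vtx s^-1)).
  - exact: perm_vtx_orthochronous.
  - exact: perm_vtx_orthochronous.
  - by have := perm_vtxV s^-1; rewrite invgK.
rewrite /proj_map -/(V i) vtx_perm projZ ?liftK //.
by rewrite mulf_neq0 ?invr_eq0.
Qed.

End Balanced.
End Regular.

Theorem theorem1p1 (R : realType) (n : nat) (hn : (2 <= n)%N)
    (v : 'I_n.+1 -> 'rV[R]_n) (hv : simplex v) (hvt : total_simplex v) :
  exists r : R,
    [/\ is_inradius v r,
        r <= atanh (1 / n%:R) &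
        (r = atanh (1 / n%:R) <-> ideal_simplex v /\ regular_simplex v)].
Proof.
exists (inrad v); split; first exact: inrad_is_inradius.
  exact: inrad_le.
rewrite inrad_eq //; split=> [/incenter_eq_balanced[]// m m0 mB|[vi vr]].
  exact: balanced_ideal_regular mB.
have [m m0 mB] := balanced_of_regular hn hv hvt vi vr; exact: balanced_incenter mB.
Qed.
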